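(* Let $(M,\phi_\alpha,\xi_\alpha,\eta_\alpha,g)$, $\alpha\in\{1,2,3\}$, be a 3-quasi-Sasakian manifold of rank $4l+3$, and let $c$ be the constant such that $[\xi_\alpha,\xi_\beta]=c\,\xi_\gamma$ for every even permutation $(\alpha,\beta,\gamma)$ of $\{1,2,3\}$. Then for each $\alpha\in\{1,2,3\}$ and all vector fields $X,Y,Z,W$ on $M$, $$g(R_{XY}\phi_\alpha Z,W)+g(R_{XY}Z,\phi_\alpha W)=-P_{\alpha}(X,Y,Z,W),$$ where $P_\alpha$ is the tensor defined by $$\begin{aligned} P_{\alpha}(X,Y,Z,W)=\frac{c^2}{4}\bigl(&\Psi_\alpha(Y,Z)\Psi_\alpha(X,\psi_\alpha W)-\Psi_\alpha(X,Z)\Psi_\alpha(Y,\psi_\alpha W)\\ &+\Psi_\alpha(Y,\psi_\alpha Z)\Psi_\alpha(X,W)-\Psi_\alpha(X,\psi_\alpha Z)\Psi_\alpha(Y,W)\\ &-\eta_\alpha(X)\eta_\alpha(W)\Psi_\alpha(Y,Z)-\eta_\alpha(Y)\eta_\alpha(Z)\Psi_\alpha(X,W)\\ &+\eta_\alpha(Y)\eta_\alpha(W)\Psi_\alpha(X,Z)+\eta_\alpha(X)\eta_\alpha(Z)\Psi_\alpha(Y,W)\bigr). \end{aligned}$$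
   Context: All manifolds are smooth and connected. An almost contact metric structure $(\phi,\xi,\eta,g)$ on $M$ consists of a $(1,1)$-tensor field $\phi$, a vector field $\xi$, a 1-form $\eta$ and a Riemannian metric $g$ with $\phi^2=-I+\eta\otimes\xi$, $\eta(\xi)=1$, $g(\phi X,\phi Y)=g(X,Y)-\eta(X)\eta(Y)$. Convention: $d\eta(X,Y)=X(\eta(Y))-Y(\eta(X))-\eta([X,Y])$. The structure is normal if $[\phi,\phi]+d\eta\otimes\xi=0$, where $[\phi,\phi]$ is the Nijenhuis torsion. Put $\Phi(X,Y)=g(X,\phi Y)$. The structure is quasi-Sasakian if it is normal and $d\Phi=0$. A quasi-Sasakian manifold has rank $2p+1$ if $\eta\wedge(d\eta)^p\neq0$ and $(d\eta)^{p+1}=0$ on $M$. A 3-quasi-Sasakian manifold is a manifold of dimension $4n+3$ with three quasi-Sasakian structures $(\phi_\alpha,\xi_\alpha,\eta_\alpha,g)$, $\alpha\in\{1,2,3\}$, with the same metric $g$, such that for every even permutation $(\alpha,\beta,\gamma)$ of $\{1,2,3\}$: $\phi_\gamma=\phi_\alpha\phi_\beta-\eta_\beta\otimes\xi_\alpha=-\phi_\beta\phi_\alpha+\eta_\alpha\otimes\xi_\beta$, $\xi_\gamma=\phi_\alpha\xi_\beta=-\phi_\beta\xi_\alpha$, $\eta_\gamma=\eta_\alpha\circ\phi_\beta=-\eta_\beta\circ\phi_\alpha$. It is known that there is a constant $c\in\mathbb{R}$ with $[\xi_\alpha,\xi_\beta]=c\,\xi_\gamma$ for every even permutation; that $\eta_1,\eta_2,\eta_3$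 have the same rank (the rank of $M$); and that the rank is either $1$ (exactly when $c=0$) or $4l+3$ for some $l\le n$. Let $\mathcal{H}=\bigcap_{\alpha}\ker\eta_\alpha$. For rank $4l+3$, with $m=n-l$, put $\mathcal{E}^{4m}=\{X\in\mathcal{H} : i_Xd\eta_\alpha=0 \text{ for } \alpha=1,2,3\}$ and $\mathcal{E}^{4l+3}=(\mathcal{E}^{4m})^\perp$. Define the $(1,1)$-tensor $\psi_\alpha$ by $\psi_\alpha=\phi_\alpha$ on $\mathcal{E}^{4l+3}$ and $\psi_\alpha=0$ on $\mathcal{E}^{4m}$, and put $\Psi_\alpha(X,Y)=g(X,\psi_\alpha Y)$. $\nabla$ is the Levi-Civita connection of $g$ and $R_{XY}=\nabla_X\nabla_Y-\nabla_Y\nabla_X-\nabla_{[X,Y]}$. The expression $R_{XY}\phi_\alpha Z$ means $R_{XY}(\phi_\alpha Z)$. *)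

(* Defs.v *)
From HB Require Import structures.
From mathcomp Require Import all_boot all_order all_algebra.
From mathcomp Require Import perm.
From mathcomp Require Import all_classical all_reals all_analysis.

Set Implicit Arguments.
Unset Strict Implicit.
Unset Printing Implicit Defensive.

Import Order.TTheory GRing.Theory Num.Theory.
Import numFieldNormedType.Exports.

Local Open Scope classical_set_scope.
Local Open Scope ring_scope.

Section Ck.
Context {R : realType} {d : nat}.
Implicit Types (U : set 'rV[R]_d) (f g : 'rV[R]_d -> R).

(* All iterated partial derivatives of order at most [k] exist and are
   continuous on [U]; only meaningful for [U] open. *)
Fixpoint Ck (k : nat) U f : Prop :=
  (forall x, U x -> {for x, continuous f}) /\
  if k is k'.+1 then
    forall i : 'I_d,
      (forall x, U x -> derivable f x (delta_mx 0 i)) /\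
      Ck k' U ('D_(delta_mx 0 i) f)
  else True.

Definition smooth_on U f : Prop := forall k, Ck k U f.

Lemma CkS k U f : Ck k.+1 U f -> Ck k U f.
Proof.
elim: k f => [|k IH] f [fc fD]; split=> // i.
by split; [exact: (fD i).1 | apply: IH; exact: (fD i).2].
Qed.

Lemma Ck_ext k U f g : open U -> (forall x, U x -> f x = g x) ->
  Ck k U f -> Ck k U g.
Proof.
move=> oU.
have near_fg f' g' x : (forall x, U x -> f' x = g' x) -> U x ->
    \near x, f' x = g' x.
  by move=> fg Ux; apply: filterS (open_nbhs_nbhs (conj oU Ux)).
have cont f' g' x : (forall x, U x -> f' x = g' x) -> U x ->
    {for x, continuous f'} -> {for x, continuous g'}.
  move=> fg Ux fc; rewrite /prop_for /continuous_at -(fg x Ux).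
  by apply: cvg_trans fc; apply: (@near_eq_cvg _ _ (nbhs x)); exact: near_fg fg Ux.
elim: k f g => [|k IH] f g fg [fc fD].
  by split=> // x Ux; exact: cont fg Ux (fc x Ux).
split=> [x Ux|i]; first exact: cont fg Ux (fc x Ux).
have [fd fk] := fD i; split=> [x Ux|].
  by apply: near_eq_derivable (fd x Ux); exact: near_fg fg Ux.
by apply: IH fk => x Ux; apply: near_eq_derive; exact: near_fg fg Ux.
Qed.

Lemma Ck_cst k U (a : R) : Ck k U (cst a).
Proof.
elim: k a => [|k IH] a; first by split=> // x _; exact: cst_continuous.
split=> [x _|i]; first exact: cst_continuous.
split=> [x _|]; first exact: derivable_cst.
rewrite (_ : 'D_(delta_mx 0 i) (cst a) = cst 0); first exact: IH.
by apply/funext => x; rewrite derive_cst.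
Qed.

Lemma Ck_sub k U f g : open U -> Ck k U f -> Ck k U g -> Ck k U (f - g).
Proof.
move=> oU; have cB f' g' x : {for x, continuous f'} -> {for x, continuous g'} ->
    {for x, continuous (f' - g')} by exact: continuousB.
elim: k f g => [|k IH] f g [fc fD] [gc gD].
  by split=> // x Ux; exact: cB (fc x Ux) (gc x Ux).
split=> [x Ux|i]; first exact: cB (fc x Ux) (gc x Ux).
have [fd fk] := fD i; have [gd gk] := gD i.
split=> [x Ux|]; first by apply: derivableB; [exact: fd|exact: gd].
apply: Ck_ext oU _ (IH _ _ fk gk) => x Ux.
by rewrite deriveB; [|exact: fd|exact: gd].
Qed.

Lemma Ck_add k U f g : open U -> Ck k U f -> Ck k U g -> Ck k U (f + g).
Proof.
move=> oU fk gk; rewrite -[g]opprK -[- g]sub0r.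
by do 2![apply: Ck_sub => //]; exact: Ck_cst.
Qed.

Lemma Ck_mul k U f g : open U -> Ck k U f -> Ck k U g -> Ck k U (f * g).
Proof.
move=> oU; have cM f' g' x : {for x, continuous f'} -> {for x, continuous g'} ->
    {for x, continuous (f' * g')} by exact: continuousM.
elim: k f g => [|k IH] f g fk0 gk0; have [fc fD] := fk0; have [gc gD] := gk0.
  by split=> // x Ux; exact: cM (fc x Ux) (gc x Ux).
split=> [x Ux|i]; first exact: cM (fc x Ux) (gc x Ux).
have [fd fk] := fD i; have [gd gk] := gD i.
split=> [x Ux|]; first by apply: derivableM; [exact: fd|exact: gd].
have := Ck_add oU (IH _ _ (CkS fk0) gk) (IH _ _ (CkS gk0) fk).
apply: Ck_ext oU _ => x Ux.
by rewrite deriveM; [|exact: fd|exact: gd].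
Qed.

End Ck.

(* A chart onto an open subset of R^d, carried with its inverse [ipt]; the
   values of [coord] off [cdom] and of [ipt] off [coord @` cdom] are junk. *)
Record chart (R : realType) (d : nat) (T : topologicalType) := Chart {
  cdom : set T;
  coord : T -> 'rV[R]_d;
  ipt : 'rV[R]_d -> T;
  cdom_open : open cdom;
  cimg_open : open (coord @` cdom);
  coordK : forall x, cdom x -> ipt (coord x) = x;
  coord_continuous : forall x, cdom x -> {for x, continuous coord};
  ipt_continuous : forall y, (coord @` cdom) y -> {for y, continuous ipt} }.

(* The atlas is not required to be maximal: smooth functions only depend on
   the maximal atlas containing it. *)
Record manifold (R : realType) (d : nat) := Manifold {
  mpoint :> topologicalType;
  manifold_hausdorff : hausdorff_space mpoint;
  manifold_second_countable : @second_countable mpoint;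
  manifold_connected : connected [set: mpoint];
  atlas : set (chart R d mpoint);
  atlas_cover : forall x, exists2 a, atlas a & cdom a x;
  atlas_compat : forall a b, atlas a -> atlas b -> forall i : 'I_d,
    smooth_on (coord a @` (cdom a `&` cdom b))
              (fun y => coord b (ipt a y) 0 i) }.

Section Smooth.
Context {R : realType} {d : nat} (M : manifold R d).

Definition smooth (f : M -> R) : Prop :=
  forall a, atlas a -> smooth_on (coord a @` cdom a) (f \o ipt a).

Record Cinf := MkCinf { Cinf_fun :> M -> R ; Cinf_smooth : `[< smooth Cinf_fun >] }.

HB.instance Definition _ := [isSub for Cinf_fun].
HB.instance Definition _ := [Choice of Cinf by <:].

Lemma smooth_cst (a : R) : smooth (cst a).
Proof. by move=> b _ k; exact: Ck_cst. Qed.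

Fact smooth_subring : subring_closed (fun f : M -> R => `[< smooth f >]).
Proof.
split; first by apply/asboolP; exact: smooth_cst.
- move=> f g /asboolP fs /asboolP gs; apply/asboolP => a aa k.
  by have := Ck_sub (@cimg_open _ _ _ a) (fs a aa k) (gs a aa k).
- move=> f g /asboolP fs /asboolP gs; apply/asboolP => a aa k.
  by have := Ck_mul (@cimg_open _ _ _ a) (fs a aa k) (gs a aa k).
Qed.

HB.instance Definition _ :=
  GRing.SubChoice_isSubComPzRing.Build _ _ Cinf smooth_subring.

Definition constf (a : R) : Cinf := MkCinf (asboolT (smooth_cst a)).

End Smooth.
Arguments constf {R d M} a.

(* Vector fields are the R-linear derivations of [Cinf M]; tensor fields are
   maps between them that are multilinear over [Cinf M]. *)
Section VectorFields.
Context {R : realType} {d : nat} (M : manifold R d).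

Definition derivation (D : Cinf M -> (Cinf M)^o) : Prop :=
  (forall (a : R) (f h : Cinf M), D (constf a * f + h) = constf a * D f + D h)
  /\ (forall f h : Cinf M, D (f * h) = D f * h + f * D h).

Record vfield := VField {
  vf_fun :> Cinf M -> (Cinf M)^o; vf_derivation : `[< derivation vf_fun >] }.

HB.instance Definition _ := [isSub for vf_fun].
HB.instance Definition _ := [Choice of vfield by <:].

Fact derivation_submod :
  GRing.subsemimod_closed (fun D : Cinf M -> (Cinf M)^o => `[< derivation D >]).
Proof.
have addE (D E : Cinf M -> (Cinf M)^o) f : (D + E) f = (D f : Cinf M) + E f by [].
have scaleE u (D : Cinf M -> (Cinf M)^o) f : (u *: D) f = u * (D f : Cinf M) by [].
split; first split.
- by apply/asboolP; split=> * /=; rewrite ?(mulr0, mul0r, addr0).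
- move=> D E /asboolP[Dl DM] /asboolP[El EM]; apply/asboolP.
  split=> [a f h|f h]; rewrite !addE.
    by rewrite Dl El mulrDr addrACA.
  by rewrite DM EM mulrDl mulrDr addrACA.
- move=> u D /asboolP[Dl DM]; apply/asboolP.
  split=> [a f h|f h]; rewrite !scaleE.
    by rewrite Dl mulrDr mulrCA.
  by rewrite DM mulrDr !mulrA (mulrC f u).
Qed.

HB.instance Definition _ :=
  GRing.SubChoice_isSubLmodule.Build _ _ _ vfield derivation_submod.

Fact bracket_derivation (X Y : vfield) :
  `[< derivation (fun f => X (Y f) - Y (X f)) >].
Proof.
have /asboolP[Xl XM] := vf_derivation X; have /asboolP[Yl YM] := vf_derivation Y.
have e1 : constf 1 = 1 :> Cinf M by exact: val_inj.
have XD f h : X (f + h) = (X f : Cinf M) + X h.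
  by have := Xl 1 f h; rewrite e1 !mul1r.
have YD f h : Y (f + h) = (Y f : Cinf M) + Y h.
  by have := Yl 1 f h; rewrite e1 !mul1r.
apply/asboolP; split=> [a f h|f h].
  by rewrite Yl Xl (Xl a f) (Yl a (X f)) opprD addrACA mulrBr.
rewrite YM XM XD YD !XM !YM mulrBl mulrBr !opprD !addrA; move: (f * _) => D.
rewrite (addrAC _ (- (Y (X f) * h)) (- (X f * Y h))) (addrAC _ D) addrK.
rewrite (addrAC _ (- (Y (X f) * h)) (- (Y f * X h))) (addrAC _ D) addrK.
by rewrite (addrAC _ D).
Qed.

Definition bracket (X Y : vfield) : vfield := VField (bracket_derivation X Y).

(* The tangent vector [X_x], as a derivation at [x]. *)
Definition tvec (X : vfield) (x : M) : Cinf M -> R := fun f => (X f : Cinf M) x.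

End VectorFields.

Section Tensors.
Context {R : realType} {d : nat} {M : manifold R d}.
Local Notation V := (vfield M).

(* No factor 1/2 here, hence 1 / (p! q!) in [wedge]. *)
Definition ext_d1 (eta : V -> Cinf M) (X Y : V) : Cinf M :=
  X (eta Y) - Y (eta X) - eta (bracket X Y).

Definition ext_d2 (w : V -> V -> Cinf M) (X Y Z : V) : Cinf M :=
  X (w Y Z) - Y (w X Z) + Z (w X Y)
  - w (bracket X Y) Z + w (bracket X Z) Y - w (bracket Y Z) X.

Definition form k : Type := ('I_k -> V) -> Cinf M.

Definition form1 (eta : V -> Cinf M) : form 1 := fun X => eta (X 0).
Definition form2 (w : V -> V -> Cinf M) : form 2 := fun X => w (X 0) (X 1).

Definition wedge p q (w : form p) (t : form q) : form (p + q) := fun X =>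
  constf ((p`! * q`!)%:R^-1) *
  \sum_(s : 'S_(p + q)) (-1) ^+ s * w (fun i => X (s (lshift q i)))
                                  * t (fun j => X (s (rshift p j))).

Fixpoint wedge_pow (w : form 2) p : form (p * 2) :=
  match p return form (p * 2) with
  | 0%N => fun=> 1
  | p'.+1 => wedge w (@wedge_pow w p')
  end.

Record riemannian_metric (g : V -> V -> Cinf M) : Prop := {
  metric_linear : forall X : V, scalar (g X);
  metric_sym : forall X Y : V, g X Y = g Y X;
  metric_ge0 : forall (X : V) (x : M), 0 <= g X X x;
  metric_definite : forall (X : V) (x : M), g X X x = 0 -> tvec X x = tvec 0 x }.

Record levi_civita (g : V -> V -> Cinf M) (nabla : V -> V -> V) : Prop := {
  lc_linear : forall Y : V, linear (nabla^~ Y);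
  lc_additive : forall X Y Z : V, nabla X (Y + Z) = nabla X Y + nabla X Z;
  lc_leibniz : forall (X : V) (f : Cinf M) (Y : V),
    nabla X (f *: Y) = (X f : Cinf M) *: Y + f *: nabla X Y;
  lc_torsion_free : forall X Y : V, nabla X Y - nabla Y X = bracket X Y;
  lc_metric : forall X Y Z : V, X (g Y Z) = g (nabla X Y) Z + g Y (nabla X Z) }.

Definition curvature (nabla : V -> V -> V) (X Y Z : V) : V :=
  nabla X (nabla Y Z) - nabla Y (nabla X Z) - nabla (bracket X Y) Z.

Record almost_contact_metric (phi : {linear V -> V}) (xi : V)
    (eta : {scalar V}) (g : V -> V -> Cinf M) : Prop := {
  acm_metric : riemannian_metric g;
  acm_phi2 : forall X : V, phi (phi X) = - X + (eta X : Cinf M) *: xi;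
  acm_eta_xi : eta xi = 1;
  acm_compat : forall X Y : V, g (phi X) (phi Y) = g X Y - eta X * eta Y }.

Definition nijenhuis (phi : V -> V) (X Y : V) : V :=
  phi (phi (bracket X Y)) + bracket (phi X) (phi Y)
  - phi (bracket (phi X) Y) - phi (bracket X (phi Y)).

Definition normal (phi : V -> V) (xi : V) (eta : V -> Cinf M) : Prop :=
  forall X Y : V, nijenhuis phi X Y + ext_d1 eta X Y *: xi = 0.

Definition fund_form (g : V -> V -> Cinf M) (phi : V -> V) (X Y : V) : Cinf M :=
  g X (phi Y).

Record quasi_sasakian (phi : {linear V -> V}) (xi : V) (eta : {scalar V})
    (g : V -> V -> Cinf M) : Prop := {
  qs_acm : almost_contact_metric phi xi eta g;
  qs_normal : normal phi xi eta;
  qs_closed : forall X Y Z : V, ext_d2 (fund_form g phi) X Y Z = 0 }.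

(* The first condition is that eta /\ (d eta)^p vanishes at no point. *)
Definition has_rank (eta : V -> Cinf M) (r : nat) : Prop :=
  exists p, [/\ r = (2 * p + 1)%N,
    forall x : M, exists X,
      wedge (form1 eta) (@wedge_pow (form2 (ext_d1 eta)) p) X x != 0 &
    forall X, @wedge_pow (form2 (ext_d1 eta)) p.+1 X = 0].

(* The index set {1, 2, 3} is ['I_3]. *)

Definition for_even_perms (P : 'I_3 -> 'I_3 -> 'I_3 -> Prop) : Prop :=
  forall s : 'S_3, ~~ odd_perm s -> P (s 0) (s 1) (s 2%:R).

Section ThreeStructures.
Variables (phi : 'I_3 -> {linear V -> V}) (xi : 'I_3 -> V).
Variables (eta : 'I_3 -> {scalar V}) (g : V -> V -> Cinf M).

Record three_quasi_sasakian : Prop := {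
  tqs_qs : forall a, quasi_sasakian (phi a) (xi a) (eta a) g;
  tqs_phi : for_even_perms (fun a b c => forall X : V,
    phi c X = phi a (phi b X) - (eta b X : Cinf M) *: xi a /\
    phi c X = - phi b (phi a X) + (eta a X : Cinf M) *: xi b);
  tqs_xi : for_even_perms (fun a b c =>
    xi c = phi a (xi b) /\ xi c = - phi b (xi a));
  tqs_eta : for_even_perms (fun a b c => forall X : V,
    eta c X = eta a (phi b X) /\ eta c X = - eta b (phi a X)) }.

(* [in_H X x], [in_E4m X x] and [in_E4l3 X x] say that the tangent vector [X_x]
   lies in the fibre at [x] of the corresponding distribution. *)
Definition in_H (X : V) (x : M) : Prop := forall a, (eta a X : Cinf M) x = 0.

Definition in_E4m (X : V) (x : M) : Prop :=
  in_H X x /\ forall a (Y : V), ext_d1 (eta a) X Y x = 0.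

Definition in_E4l3 (X : V) (x : M) : Prop :=
  forall Y : V, in_E4m Y x -> g X Y x = 0.

(* This determines [psi], as T_x M is the sum of the two fibres. *)
Definition is_psi (psi : 'I_3 -> {linear V -> V}) : Prop :=
  forall a (X : V) (x : M),
    (in_E4l3 X x -> tvec (psi a X) x = tvec (phi a X) x) /\
    (in_E4m X x -> tvec (psi a X) x = tvec 0 x).

End ThreeStructures.

Definition P_tensor (c : R) (eta : V -> Cinf M) (psi : V -> V)
    (g : V -> V -> Cinf M) (X Y Z W : V) : Cinf M :=
  let Psi := fund_form g psi in
  constf (c ^+ 2 / 4%:R) *
  (Psi Y Z * Psi X (psi W) - Psi X Z * Psi Y (psi W)
   + Psi Y (psi Z) * Psi X W - Psi X (psi Z) * Psi Y W
   - eta X * eta W * Psi Y Z - eta Y * eta Z * Psi X W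
   + eta Y * eta W * Psi X Z + eta X * eta Z * Psi Y W).

End Tensors.

(* Main.v *)
(* Write k = - c / 2.  For a single quasi-Sasakian structure, normality and
   closedness of Phi make xi Killing and give
   (nabla_X phi) Y = eta(Y) A X - g(A X, Y) xi, where A is a symmetric operator
   commuting with phi and nabla_X xi = phi (A X).  For a 3-quasi-Sasakian
   structure A can be chosen independently of alpha so that
   A xi_alpha = k xi_alpha.  The equations d (d eta_alpha) = 0 then force
   A^2 = k A and nabla A = 0: their vertical components equate a symmetric form
   with a skew one, and on horizontal vectors the forms g(phi_alpha A X, Y)
   can only be closed together if A is parallel, by an argument similar to
   the Hitchin lemma for hyperkaehler structures.  Hence psi_alpha = phi_alpha A/k
   if c <> 0 and A = 0 if c = 0, and the commutator of R_XY with phi_alpha is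
   obtained by differentiating the formula for nabla phi_alpha once more. *)
Require Import Defs.
From mathcomp Require Import all_boot all_order all_algebra.
From mathcomp Require Import perm ring lra.
From mathcomp Require Import all_classical all_reals all_analysis.

Set Implicit Arguments.
Unset Strict Implicit.
Unset Printing Implicit Defensive.

Import GRing.Theory Num.Theory.

Local Open Scope ring_scope.

(** * Algebra of smooth functions, derivations and Lie brackets *)

Section CinfTheory.
Context {R : realType} {d : nat} {M : manifold R d}.
Implicit Types (f h : Cinf M) (X Y Z : vfield M) (x : M).

Lemma CinfP f h : (forall x, f x = h x) <-> f = h.
Proof. by split=> [fh|-> //]; apply/val_inj/funext. Qed.

Lemma CinfD f h x : (f + h) x = f x + h x. Proof. by []. Qed.
Lemma CinfN f x : (- f) x = - f x. Proof. by []. Qed.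
Lemma CinfM f h x : (f * h) x = f x * h x. Proof. by []. Qed.
Lemma Cinf0 x : (0 : Cinf M) x = 0. Proof. by []. Qed.
Lemma Cinf1 x : (1 : Cinf M) x = 1. Proof. by []. Qed.
Lemma CinfC (a : R) x : (constf a : Cinf M) x = a. Proof. by []. Qed.
Definition CinfE := (CinfD, CinfN, CinfM, Cinf0, Cinf1, CinfC).

Lemma vfieldP X Y : (forall f, X f = Y f) <-> X = Y.
Proof. by split=> [XY|-> //]; apply/val_inj/funext. Qed.

Lemma vfield_linear X (a : R) f h :
  X (constf a * f + h) = constf a * X f + X h :> Cinf M.
Proof. by have /asboolP[/(_ a f h)] := vf_derivation X. Qed.

Lemma vfieldD X f h : X (f + h) = (X f : Cinf M) + X h :> Cinf M.
Proof.
have c1 : constf 1 = 1 :> Cinf M by exact: val_inj.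
by have := vfield_linear X 1 f h; rewrite c1 !mul1r.
Qed.

Lemma vfieldN X f : X (- f) = - (X f : Cinf M) :> Cinf M.
Proof.
have X0 : X 0 = 0 :> Cinf M.
  by apply/(@addrI (Cinf M) (X 0)); rewrite -vfieldD !addr0.
by apply/(@addrI (Cinf M) (X f)); rewrite -vfieldD !subrr.
Qed.

Lemma vfieldM X f h : X (f * h) = X f * h + f * X h :> Cinf M.
Proof. by have /asboolP[_] := vf_derivation X; apply. Qed.

Lemma vfield_const X (a : R) : X (constf a) = 0 :> Cinf M.
Proof.
have X1 : X 1 = 0 :> Cinf M.
  apply/(@addrI (Cinf M) (X 1)); rewrite addr0.
  by have := vfieldM X 1 1; rewrite mulr1 mul1r mulr1.
rewrite -[constf a]mulr1 -[_ * 1]addr0 vfield_linear X1 mulr0 add0r.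
by rewrite -[X in _ X = _](subrr 1) vfieldD vfieldN subrr.
Qed.

Lemma bracketE X Y f : bracket X Y f = (X (Y f) : Cinf M) - Y (X f) :> Cinf M.
Proof. by []. Qed.

Lemma jacobi X Y Z :
  bracket (bracket X Y) Z + bracket (bracket Y Z) X
  + bracket (bracket Z X) Y = 0.
Proof.
apply/vfieldP => f.
change (bracket (bracket X Y) Z f + bracket (bracket Y Z) X f
  + bracket (bracket Z X) Y f = 0 :> Cinf M).
rewrite !bracketE !vfieldD !vfieldN.
ring.
Qed.

End CinfTheory.

(** * Rules of calculation for the metric and its Levi-Civita connection *)

Section LeviCivita.
Context {R : realType} {d : nat} {M : manifold R d}.
Local Notation V := (vfield M).
Context {g : V -> V -> Cinf M} {nabla : V -> V -> V}.
Hypothesis gP : riemannian_metric g.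
Hypothesis nablaP : levi_civita g nabla.
Implicit Types (X Y Z W : V) (f : Cinf M).

Lemma gC X Y : g X Y = g Y X. Proof. exact: Defs.metric_sym gP X Y. Qed.
Lemma gDr X Y Z : g X (Y + Z) = g X Y + g X Z.
Proof. by have := metric_linear gP X 1 Y Z; rewrite scale1r /= mul1r. Qed.
Lemma g0r X : g X 0 = 0.
Proof. by apply: (@addrI _ (g X 0)); rewrite -gDr !addr0. Qed.
Lemma gZr X f Y : g X (f *: Y) = f * g X Y.
Proof. by have := metric_linear gP X f Y 0; rewrite g0r /= !addr0. Qed.
Lemma gNr X Y : g X (- Y) = - g X Y.
Proof. by apply: (@addrI _ (g X Y)); rewrite -gDr !subrr g0r. Qed.
Lemma gDl X Y Z : g (X + Y) Z = g X Z + g Y Z.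
Proof. by rewrite gC gDr !(gC Z). Qed.
Lemma g0l X : g 0 X = 0. Proof. by rewrite gC g0r. Qed.
Lemma gZl f X Y : g (f *: X) Y = f * g X Y.
Proof. by rewrite gC gZr (gC Y). Qed.
Lemma gNl X Y : g (- X) Y = - g X Y.
Proof. by rewrite gC gNr (gC Y). Qed.
Definition gE := (gDl, gDr, gNl, gNr, gZl, gZr, g0l, g0r).

Lemma g_eq0 X : g X X = 0 -> X = 0.
Proof.
move=> /CinfP gX; apply/vfieldP => f; apply/CinfP => x.
by have /(congr1 (fun v => v f)) := metric_definite gP (gX x).
Qed.

Lemma g_inj X Y : (forall Z, g X Z = g Y Z) -> X = Y.
Proof.
move=> XY; apply/subr0_eq/g_eq0.
by rewrite gDl gNl XY subrr.
Qed.

Lemma nablaDl X Y Z : nabla (X + Y) Z = nabla X Z + nabla Y Z.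
Proof. by have := lc_linear nablaP Z 1 X Y; rewrite !scale1r. Qed.
Lemma nabla0l X : nabla 0 X = 0.
Proof. by apply: (@addrI _ (nabla 0 X)); rewrite -nablaDl !addr0. Qed.
Lemma nablaZl f X Y : nabla (f *: X) Y = f *: nabla X Y.
Proof. by have := lc_linear nablaP Y f X 0; rewrite nabla0l !addr0. Qed.
Lemma nablaNl X Y : nabla (- X) Y = - nabla X Y.
Proof. by apply: (@addrI _ (nabla X Y)); rewrite -nablaDl !subrr nabla0l. Qed.
Lemma nablaDr X Y Z : nabla X (Y + Z) = nabla X Y + nabla X Z.
Proof. exact: lc_additive nablaP X Y Z. Qed.
Lemma nabla0r X : nabla X 0 = 0.
Proof. by apply: (@addrI _ (nabla X 0)); rewrite -nablaDr !addr0. Qed.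
Lemma nablaNr X Y : nabla X (- Y) = - nabla X Y.
Proof. by apply: (@addrI _ (nabla X Y)); rewrite -nablaDr !subrr nabla0r. Qed.
Lemma nablaZr X f Y : nabla X (f *: Y) = (X f : Cinf M) *: Y + f *: nabla X Y.
Proof. exact: lc_leibniz nablaP X f Y. Qed.
Definition nablaE := (nablaDl, nablaDr, nablaNl, nablaNr, nablaZl, nablaZr).

Lemma bracket_nabla X Y : bracket X Y = nabla X Y - nabla Y X.
Proof. by rewrite (lc_torsion_free nablaP). Qed.

Lemma vfield_metric X Y Z :
  X (g Y Z) = g (nabla X Y) Z + g Y (nabla X Z) :> Cinf M.
Proof. exact: lc_metric nablaP X Y Z. Qed.

Lemma metric_const X Y Z (a : R) :
  g Y Z = constf a -> g (nabla X Y) Z + g Y (nabla X Z) = 0.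
Proof. by move=> gYZ; rewrite -vfield_metric gYZ vfield_const. Qed.

End LeviCivita.

(** * Algebra of a single almost contact metric structure *)

Section AlmostContact.
Context {R : realType} {d : nat} {M : manifold R d}.
Local Notation V := (vfield M).
Context {phi : {linear V -> V}} {xi : V} {eta : {scalar V}}.
Context {g : V -> V -> Cinf M}.
Hypothesis acm : almost_contact_metric phi xi eta g.
Let gP := acm_metric acm.
Implicit Types (X Y Z W : V).

Lemma phi2 X : phi (phi X) = - X + (eta X : Cinf M) *: xi.
Proof. exact: acm_phi2 acm X. Qed.

Lemma eta_xi : eta xi = 1. Proof. exact: acm_eta_xi acm. Qed.

(** As phi^2 xi = 0, also phi^3 xi = 0, which reads phi xi = eta(phi xi) xi. Applying phi and then
    eta gives eta(phi xi)^2 = 0, and compatibility turns this into g(phi xi, phi xi) = 0. *)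
Lemma phi_xi : phi xi = 0.
Proof.
have p2 : phi (phi xi) = 0 by rewrite phi2 eta_xi scale1r addNr.
have := phi2 (phi xi); rewrite p2 linear0 => /esym/eqP.
rewrite addrC subr_eq0 => /eqP px.
have e2 : (eta (phi xi) : Cinf M) * eta (phi xi) = 0.
  have : phi ((eta (phi xi) : Cinf M) *: xi) = 0 by rewrite px p2.
  by rewrite linearZ_LR => /(congr1 eta); rewrite linearZ_LR linear0.
apply: (g_eq0 gP); have := acm_compat acm (phi xi) (phi xi).
by rewrite p2 (g0l gP) e2 subr0.
Qed.

Lemma etaE X : eta X = g X xi.
Proof.
have := acm_compat acm X xi.
by rewrite phi_xi eta_xi mulr1 (g0r gP) => /esym/subr0_eq.
Qed.

(** The two ways of computing phi^3 X differ by eta(phi X) xi. *)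
Lemma eta_phi X : eta (phi X) = 0.
Proof.
have := congr1 phi (phi2 X).
rewrite phi2 linearD linearN linearZ_LR phi_xi scaler0 => /addrI/(congr1 eta).
by rewrite linear0 linearZ_LR /= eta_xi mulr1.
Qed.

Lemma g_phi X Y : g (phi X) (phi Y) = g X Y - eta X * eta Y.
Proof. exact: acm_compat acm X Y. Qed.

Lemma g_phil X Y : g (phi X) Y = - g X (phi Y).
Proof.
have := g_phi X (phi Y); rewrite phi2 eta_phi mulr0 subr0 => <-.
by rewrite (gDr gP) (gNr gP) (gZr gP) -etaE eta_phi mulr0 addr0 opprK.
Qed.

End AlmostContact.

(** [Cinf M] is only a commutative ring; evaluation at a point moves an identity into the ordered
    field [R], where [lra] applies. *)
Ltac at_pt x H := move: H => /CinfP /(_ x); rewrite ?CinfE.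

(** * Covariant derivatives of xi and phi on a quasi-Sasakian manifold *)

Section QuasiSasakian.
Context {R : realType} {d : nat} {M : manifold R d}.
Local Notation V := (vfield M).
Context {phi : {linear V -> V}} {xi : V} {eta : {scalar V}}.
Context {g : V -> V -> Cinf M} {nabla : V -> V -> V}.
Hypothesis qs : quasi_sasakian phi xi eta g.
Hypothesis nablaP : levi_civita g nabla.
Let acm := qs_acm qs.
Let gP := acm_metric acm.
Implicit Types (X Y Z W : V).

(** [th] is nabla eta, which is half of d eta once it is known to be skew. [F X Y] is (nabla_X phi)
    Y, and [f] is its trilinear form. *)
Let th X Y := g (nabla X xi) Y.
Let F X Y := nabla X (phi Y) - phi (nabla X Y).
Let f X Y Z := g (F X Y) Z.

Let phiD X Y : phi (X + Y) = phi X + phi Y. Proof. exact: linearD. Qed.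
Let phiN X : phi (- X) = - phi X. Proof. exact: linearN. Qed.
Let etaD X Y : eta (X + Y) = (eta X : Cinf M) + eta Y.
Proof. exact: linearD. Qed.
Let etaN X : eta (- X) = - (eta X : Cinf M).
Proof. exact: linearN. Qed.

Let th_xir X : th X xi = 0.
Proof.
have gxi : g xi xi = constf 1.
  by rewrite -(etaE acm) (eta_xi acm); apply/val_inj.
have := metric_const nablaP X gxi; rewrite (gC gP xi).
move=> H; apply/CinfP => x; at_pt x H; rewrite /th; lra.
Qed.

Let ext_d1_th X Y : ext_d1 eta X Y = th X Y - th Y X.
Proof.
rewrite /ext_d1 (bracket_nabla nablaP) etaD etaN !(etaE acm).
rewrite !(vfield_metric nablaP) -!(gC gP xi).
rewrite /th !(gC gP _ (nabla _ xi)).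
ring.
Qed.

Let f_skew X Y Z : f X Y Z = - f X Z Y.
Proof.
have := congr1 (fun h => X h : Cinf M) (g_phil acm Y Z).
rewrite /= vfieldN !(vfield_metric nablaP) => H.
rewrite /f /F !(gE gP) !(g_phil acm) (gC gP (nabla X (phi Z))).
apply/CinfP => x; at_pt x H; at_pt x (g_phil acm Y (nabla X Z)).
rewrite !(gC gP (phi _)); lra.
Qed.

(** Up to sign the cyclic sum is d Phi, since nabla has no torsion. *)
Let f_cyc X Y Z : f X Y Z + f Y Z X + f Z X Y = 0.
Proof.
have fE U A B : f U A B = g B (nabla U (phi A)) + g (nabla U A) (phi B).
  by rewrite /f /F !(gE gP) (g_phil acm) opprK (gC gP B).
rewrite (f_skew X) (f_skew Z) !fE.
have H := qs_closed qs X Y Z; rewrite /ext_d2 /fund_form in H.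
rewrite !(vfield_metric nablaP) !(bracket_nabla nablaP) !(gE gP) in H.
apply/CinfP => x; at_pt x H; lra.
Qed.

Let gphir X Y : g X (phi Y) = - g (phi X) Y.
Proof. by rewrite (g_phil acm) opprK. Qed.

(* The derivative along X of phi^2 = - 1 + eta * xi. *)
Let f_phi X Y Z :
  f X (phi Y) Z - f X Y (phi Z) = th X Y * eta Z + eta Y * th X Z.
Proof.
have Xeta : X (eta Y) = eta (nabla X Y) + th X Y :> Cinf M.
  by rewrite !(etaE acm) (vfield_metric nablaP) /th (gC gP Y).
rewrite /f /F !(gE gP) !gphir (phi2 acm (nabla X Y)) (phi2 acm Y).
rewrite !(nablaE nablaP) !(gE gP) Xeta (etaE acm Z) (gC gP Z) /th.
ring.
Qed.

Let f_normal X Y Z : f (phi X) Y Z - f (phi Y) X Z - f Y X (phi Z)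
  + f X Y (phi Z) + (th X Y - th Y X) * eta Z = 0.
Proof.
have H := congr1 (g^~ Z) (qs_normal qs X Y); rewrite /nijenhuis ext_d1_th in H.
rewrite !(bracket_nabla nablaP) !phiD !phiN !(gE gP) in H.
rewrite /f /F !(gE gP) !gphir (etaE acm Z) (gC gP Z) -[RHS]H.
ring.
Qed.

Let f_xi X Z : f X xi Z = th X (phi Z).
Proof.
rewrite /f /F (phi_xi acm) (nabla0r nablaP) sub0r (gNl gP) (g_phil acm).
by rewrite opprK.
Qed.

Let f0 U W : f 0 U W = 0.
Proof. by rewrite /f /F !(nabla0l nablaP) linear0 subr0 (g0l gP). Qed.

Let f_phi2r X Y Z : f X Y (phi (phi Z)) = - f X Y Z + eta Z * f X Y xi.
Proof. by rewrite (phi2 acm) /f !(gE gP); ring. Qed.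
Let th_phi2r X Z : th X (phi (phi Z)) = - th X Z.
Proof. by rewrite (phi2 acm) /th !(gE gP) -/(th X xi) th_xir mulr0 addr0. Qed.

Let f_xi_phi X Z :
  f xi X (phi Z) = th (phi X) (phi Z) - th X Z - th xi X * eta Z.
Proof.
have H := f_normal X xi Z.
rewrite !f_xi (phi_xi acm) f0 th_xir th_phi2r in H.
apply/CinfP => x; at_pt x H; lra.
Qed.

Let th_xil X : th xi X = 0.
Proof.
have := f_xi_phi X xi.
rewrite (phi_xi acm) th_xir (eta_xi acm) {1}/f {1}/th !(g0r gP) mulr1.
by move=> H; apply/CinfP => x; at_pt x H; lra.
Qed.

Let f_xil X Z : f xi X Z = th (phi X) Z + th X (phi Z).
Proof.
have := f_xi_phi X (phi Z).
rewrite f_phi2r th_phi2r (f_skew _ X xi) f_xi !th_xil => H.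
apply/CinfP => x; at_pt x H; lra.
Qed.

Lemma g_nabla_xi X : g (nabla X xi) xi = 0.
Proof. exact: th_xir. Qed.

(** Closedness of Phi with xi in one slot makes [th] skew as soon as one argument lies in the image
    of phi. By the formula for phi^2 only the direction xi remains, and there [th] vanishes in both
    slots. *)
Lemma xi_killing X Y : g (nabla X xi) Y = - g X (nabla Y xi).
Proof.
have H U W : th (phi U) W + th W (phi U) = 0.
  have := f_cyc xi U W; rewrite f_xil f_skew !f_xi => H.
  by apply/CinfP => x; at_pt x H; lra.
have := H (phi X) Y; rewrite (phi2 acm) /th !(nablaE nablaP) !(gE gP).
rewrite -!/(th _ _) th_xir th_xil !mulr0 !addr0 (gC gP X (nabla _ _)).
rewrite -/(th X Y) -/(th Y X) => H1.
by apply/CinfP => x; at_pt x H1; lra.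
Qed.

Let th_skew X Y : th X Y = - th Y X.
Proof. by rewrite /th xi_killing (gC gP X). Qed.

Let th_phi X Y : th (phi X) (phi Y) = th X Y.
Proof.
have := f_normal X Y xi.
rewrite (f_skew _ _ xi) (f_skew (phi Y) _ xi) !f_xi (phi_xi acm) (eta_xi acm).
rewrite /f !(g0r gP) (th_skew (phi Y)) (th_skew Y) => H.
by apply/CinfP => x; at_pt x H; lra.
Qed.

(** One instance of normality, two of closedness and three of the differentiated formula for phi^2
    form a linear system in values of [f]; skewness of [f] and [th] makes it solvable. *)
Let f_phir X Y Z : f X Y (phi Z) = eta Y * th Z X.
Proof.
apply/CinfP => x.
at_pt x (f_normal Y Z X).
at_pt x (f_cyc (phi Y) Z X); at_pt x (f_cyc (phi Z) X Y).
at_pt x (f_phi Y Z X); at_pt x (f_phi Z Y X); at_pt x (f_phi X Y Z).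
rewrite (f_skew (phi Z) Y) (f_skew Z X).
rewrite (th_skew Y Z) (th_skew Y X) (th_skew X Z) !CinfE.
lra.
Qed.

Lemma nabla_phi_form X Y Z :
  g (nabla X (phi Y)) Z = g (phi (nabla X Y)) Z
    + eta Y * g (nabla X xi) (phi Z) - eta Z * g (nabla X xi) (phi Y).
Proof.
have := f_phir X Y (phi Z).
rewrite f_phi2r (f_skew _ _ xi) f_xi (th_skew (phi Z)) /f /F /th !(gE gP) => H.
apply/CinfP => x; at_pt x H; lra.
Qed.

Lemma nabla_xi_phi X Y : g (nabla (phi X) xi) Y = - g (nabla X xi) (phi Y).
Proof.
have H := th_phi X (phi Y).
by rewrite th_phi2r in H; apply/CinfP => x; at_pt x H; rewrite /th; lra.
Qed.

Lemma ext_d1_xi X Y : ext_d1 eta X Y = constf 2 * g (nabla X xi) Y.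
Proof.
rewrite ext_d1_th; apply/CinfP => x; at_pt x (th_skew X Y); rewrite /th; lra.
Qed.

End QuasiSasakian.

Lemma even_perms_cyclic (P : 'I_3 -> 'I_3 -> 'I_3 -> Prop) :
  for_even_perms P -> forall a, P a (a + 1) (a + 1 + 1).
Proof.
move=> PP a; pose s b := perm (@addrI _ (b : 'I_3)).
have sM b b' : s (b + b') = (s b' * s b)%g.
  by apply/permP => i; rewrite permM !permE addrA.
(* In Z/3 one has a = 4a, so translation by a is the square of translation by 2a and hence even. *)
have a2 : a = (a + a) + (a + a) by case: a => -[|[|[|]]] //= ?; apply/val_inj.
have sa : ~~ odd_perm (s a) by rewrite a2 sM odd_permM addbb.
by have := PP _ sa; rewrite !permE addr0 -(addrA a).
Qed.

Lemma ord3_const (T : Type) (h : 'I_3 -> T) :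
  (forall a, h (a + 1) = h a) -> forall a, h a = h 0.
Proof.
move=> hS; have h1 := hS 0; have h2 := hS (0 + 1).
case=> -[|[|[|]]] //= ?; [|rewrite -h1|rewrite -h1 -h2];
  by congr h; apply/val_inj.
Qed.

Lemma ord3_rot (a : 'I_3) : a + 1 + 1 + 1 = a.
Proof. by case: a => -[|[|[|]]] //= ?; apply/val_inj. Qed.

(** * The operator A shared by the three structures *)

Section ThreeQuasiSasakian.
Context {R : realType} {m : nat} {M : manifold R m}.
Local Notation V := (vfield M).
Context {phi : 'I_3 -> {linear V -> V}} {xi : 'I_3 -> V}.
Context {eta : 'I_3 -> {scalar V}} {g : V -> V -> Cinf M}.
Context {nabla : V -> V -> V} {c : R}.
Hypothesis tqs : three_quasi_sasakian phi xi eta g.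
Hypothesis nablaP : levi_civita g nabla.
Hypothesis xi_bracket :
  for_even_perms (fun a b d => bracket (xi a) (xi b) = constf c *: xi d).
Implicit Types (a b d : 'I_3) (X Y Z W : V).

Let qs a := tqs_qs tqs a.
Let acm a := qs_acm (qs a).
Let gP := acm_metric (acm 0).

Definition cyclic3 a b d := b = a + 1 /\ d = b + 1.

Lemma cyclic3_rot a b d : cyclic3 a b d -> cyclic3 b d a.
Proof. by move=> [-> ->]; split; rewrite ?ord3_rot. Qed.

Section Cyclic.
Variables a b d : 'I_3.
Hypothesis abd : cyclic3 a b d.

Lemma phi_mul X : phi a (phi b X) = phi d X + (eta b X : Cinf M) *: xi a.
Proof.
have := even_perms_cyclic (tqs_phi tqs) a X; case: abd => <- <- [-> _].
by rewrite subrK.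
Qed.

Lemma phi_mulC X : phi b (phi a X) = - phi d X + (eta a X : Cinf M) *: xi b.
Proof.
have := even_perms_cyclic (tqs_phi tqs) a X; case: abd => <- <- [_ ->].
by rewrite opprD opprK subrK.
Qed.

Lemma phi_xi_mul : phi a (xi b) = xi d.
Proof.
by have := even_perms_cyclic (tqs_xi tqs) a; case: abd => <- <- [<-].
Qed.

Lemma phi_xi_mulC : phi b (xi a) = - xi d.
Proof.
have := even_perms_cyclic (tqs_xi tqs) a; case: abd => <- <- [_ ->].
by rewrite opprK.
Qed.

Lemma eta_phi_mulC X : eta b (phi a X) = - (eta d X : Cinf M).
Proof.
have := even_perms_cyclic (tqs_eta tqs) a X; case: abd => <- <- [_ ->].
by rewrite opprK.
Qed.

Lemma eta_xi_left : eta a (xi d) = 0.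
Proof. by rewrite -phi_xi_mul (eta_phi (acm a)). Qed.

Lemma eta_xi_right : eta b (xi d) = 0.
Proof.
have := eta_phi (acm b) (xi a).
by rewrite phi_xi_mulC linearN => /eqP; rewrite oppr_eq0 => /eqP.
Qed.

Lemma bracket_xi : bracket (xi a) (xi b) = constf c *: xi d.
Proof. by have := even_perms_cyclic xi_bracket a; case: abd => <- <-. Qed.

End Cyclic.

Let th a X Y := g (nabla X (xi a)) Y.

Let th_skew a X Y : th a X Y = - th a Y X.
Proof. by rewrite /th (xi_killing (qs a) nablaP) (gC gP X). Qed.

Let th_phi a X Y : th a (phi a X) Y = - th a X (phi a Y).
Proof. exact: nabla_xi_phi (qs a) nablaP X Y. Qed.

(** The bracket gives the difference of the two derivatives. Their sum is zero because [xi a] and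
    [xi b] are orthogonal Killing fields. *)
Lemma nabla_xi_xi a b d Z : cyclic3 a b d ->
  g (nabla (xi a) (xi b)) Z = constf (c / 2) * eta d Z /\
  g (nabla (xi b) (xi a)) Z = constf (- (c / 2)) * eta d Z.
Proof.
move=> abd.
have gab : g (xi a) (xi b) = constf 0.
  rewrite -(etaE (acm b)) (eta_xi_left (cyclic3_rot abd)).
  exact: val_inj.
have H1 := metric_const nablaP Z gab.
have H2 := congr1 (g^~ Z) (bracket_xi abd).
rewrite (bracket_nabla nablaP) !(gE gP) (gC gP (xi d)) -(etaE (acm d)) in H2.
have H3 := th_skew b (xi a) Z; have H4 := th_skew a (xi b) Z.
rewrite /th in H3 H4; rewrite (gC gP (xi a)) in H1.
by split; apply/CinfP => x; at_pt x H1; at_pt x H2; at_pt x H3; at_pt x H4; lra.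
Qed.

Let k : Cinf M := constf (- (c / 2)).

(* The second term, immaterial for a single structure, makes the operator
   independent of the index 0.  The lock keeps [gE] from unfolding it. *)
Definition shape : V -> V :=
  locked (fun X => - phi 0 (nabla X (xi 0)) + (k * eta 0 X) *: xi 0).
Local Notation A := shape.

(** Independence of the index: differentiating [xi d] = [phi a (xi b)] by [nabla_phi_form] compares
    the right-hand sides at d and b. The leftover terms are derivatives of one [xi] along another,
    worth c/2 up to sign, and the summand with [k] absorbs them. *)
Lemma g_shape a X Z :
  g (A X) Z = g (nabla X (xi a)) (phi a Z) + k * eta a X * eta a Z.
Proof.
rewrite /A -lock !(gE gP) (g_phil (acm 0)) opprK (gC gP (xi 0)) -(etaE (acm 0)).
pose h a := th a X (phi a Z) + k * eta a X * eta a Z.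
apply: esym; apply: (@ord3_const _ h) => {a} b; rewrite /h => {h}.
have abd : cyclic3 (b + 1 + 1) b (b + 1) by split; rewrite ?ord3_rot.
move: (b + 1 + 1) abd => a; move: (b + 1) => d abd.
have dab := cyclic3_rot (cyclic3_rot abd).
have := nabla_phi_form (qs a) nablaP X (xi b) (phi d Z).
rewrite (phi_xi_mul abd) (eta_xi_right dab) (eta_phi_mulC dab) (g_phil (acm a)).
rewrite (phi_mulC dab) !(gE gP) -!/(th _ _ _) (th_skew b X (xi a)).
rewrite mul0r addr0 (th_skew a X) /th.
rewrite (nabla_xi_xi _ dab).1 (nabla_xi_xi _ abd).1 => ->.
apply/CinfP => x; rewrite !CinfE; ring.
Qed.

Lemma shape_sym X Y : g (A X) Y = g X (A Y).
Proof.
rewrite (gC gP X) !(g_shape 0) -!/(th _ _ _) th_skew th_phi opprK.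
by rewrite -mulrA [eta 0 X * _]mulrC mulrA.
Qed.

Lemma shape_phi a X : A (phi a X) = phi a (A X).
Proof.
apply: (g_inj gP) => Z; rewrite (g_phil (acm a)) !(g_shape a).
rewrite !(eta_phi (acm a)).
rewrite (phi2 (acm a)) !(gE gP) -!/(th _ _ _) th_phi (phi2 (acm a)) /th.
rewrite !(gE gP).
by rewrite !(mulr0, mul0r) !addr0.
Qed.

Lemma nabla_xi a X : nabla X (xi a) = phi a (A X).
Proof.
apply: (g_inj gP) => Z; rewrite (g_phil (acm a)) (g_shape a) (eta_phi (acm a)).
rewrite (phi2 (acm a)) !(gE gP) (g_nabla_xi (qs a) nablaP); ring.
Qed.

Lemma shapeD X Y : A (X + Y) = A X + A Y.
Proof.
apply: (g_inj gP) => Z; rewrite !(gE gP) !(g_shape 0) (nablaDl nablaP) (gDl gP).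
rewrite (linearD (eta 0)) /=; ring.
Qed.

Lemma shapeZ (u : Cinf M) X : A (u *: X) = u *: A X.
Proof.
apply: (g_inj gP) => Z; rewrite !(gE gP) !(g_shape 0) (nablaZl nablaP) (gZl gP).
rewrite (linearZ_LR (eta 0)) /=; ring.
Qed.

Lemma shape_xi a : A (xi a) = k *: xi a.
Proof.
apply: (g_inj gP) => Z; rewrite (gZl gP) (g_shape a) (xi_killing (qs a) nablaP).
rewrite (gC gP (xi a)) (g_nabla_xi (qs a) nablaP) (eta_xi (acm a)).
by rewrite oppr0 add0r mulr1 (gC gP (xi a)) -(etaE (acm a)).
Qed.

Lemma nabla_phi a X Y :
  nabla X (phi a Y) = phi a (nabla X Y) + (eta a Y : Cinf M) *: A X
                      - g (A X) Y *: xi a.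
Proof.
apply: (g_inj gP) => Z; rewrite (nabla_phi_form (qs a) nablaP).
rewrite !(gE gP) !(g_shape a) (gC gP (xi a)) -!(etaE (acm a)).
ring.
Qed.

End ThreeQuasiSasakian.

(** The second derivatives cancel, and the terms with double brackets vanish by the Jacobi
    identity. *)
Lemma ext_d2_ext_d1 (R : realType) (m : nat) (M : manifold R m)
    (eta : {scalar vfield M}) (X Y Z : vfield M) :
  ext_d2 (ext_d1 eta) X Y Z = 0.
Proof.
have := congr1 eta (jacobi X Y Z).
have -> : bracket (bracket Z X) Y = - bracket (bracket X Z) Y.
  apply/vfieldP => f.
  change (bracket (bracket Z X) Y f = - (bracket (bracket X Z) Y f : Cinf M)).
  by rewrite !bracketE !vfieldD !vfieldN; ring.
rewrite linear0 !linearD linearN /= => H.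
rewrite /ext_d2 /ext_d1 !bracketE !vfieldD !vfieldN.
apply/CinfP => x; at_pt x H; lra.
Qed.

(** * A^2 = k A and nabla A = 0, for any A with the properties listed here *)

Section ParallelShape.
Context {R : realType} {m : nat} {M : manifold R m}.
Local Notation V := (vfield M).
Context {phi : 'I_3 -> {linear V -> V}} {xi : 'I_3 -> V}.
Context {eta : 'I_3 -> {scalar V}} {g : V -> V -> Cinf M}.
Context {nabla : V -> V -> V} {k : R} {A : V -> V}.
Hypothesis tqs : three_quasi_sasakian phi xi eta g.
Hypothesis nablaP : levi_civita g nabla.
Hypothesis AD : forall X Y, A (X + Y) = A X + A Y.
Hypothesis AZ : forall (u : Cinf M) X, A (u *: X) = u *: A X.
Hypothesis A_sym : forall X Y, g (A X) Y = g X (A Y).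
Hypothesis A_phi : forall a X, A (phi a X) = phi a (A X).
Hypothesis A_xi : forall a, A (xi a) = constf k *: xi a.
Hypothesis nabla_xi : forall a X, nabla X (xi a) = phi a (A X).
Hypothesis nabla_phi : forall a X Y, nabla X (phi a Y) =
  phi a (nabla X Y) + (eta a Y : Cinf M) *: A X - g (A X) Y *: xi a.
Implicit Types (a b d : 'I_3) (X Y Z W : V).

Let qs a := tqs_qs tqs a.
Let acm a := qs_acm (qs a).
Let gP := acm_metric (acm 0).

Let phiD a X Y : phi a (X + Y) = phi a X + phi a Y. Proof. exact: linearD. Qed.
Let phiN a X : phi a (- X) = - phi a X. Proof. exact: linearN. Qed.
Let phiZ a (u : Cinf M) X : phi a (u *: X) = u *: phi a X.
Proof. exact: linearZ_LR. Qed.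
Let phiE := (phiD, phiN, phiZ).
Let AN X : A (- X) = - A X.
Proof. by rewrite -[- X]scaleN1r AZ scaleN1r. Qed.
Let AE := (AD, AN, AZ).
Let A_eta a X : eta a (A X) = constf k * eta a X.
Proof. by rewrite !(etaE (acm a)) A_sym A_xi (gZr gP). Qed.

(** [E] is the defect of A^2 = k A and [S X Y] is (nabla_X A) Y; [e] and [Q] are the corresponding
    forms, to be shown zero. *)
Let E X := A (A X) - constf k *: A X.
Let e X Y := g (E X) Y.
Let S X Y := nabla X (A Y) - A (nabla X Y).
Let Q X Y Z := g (S X Y) Z.

Let e_sym X Y : e X Y = e Y X.
Proof. by rewrite /e /E !(gE gP) !A_sym !(gC gP X) !A_sym. Qed.

Let e_xil a X : e (xi a) X = 0.
Proof.
rewrite /e /E A_xi AZ A_xi !(gE gP); ring.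
Qed.
Let e_xir a X : e X (xi a) = 0. Proof. by rewrite e_sym e_xil. Qed.

Let e_phi a X Y : e (phi a X) Y = - e X (phi a Y).
Proof. by rewrite /e /E !A_phi -phiZ -phiN -phiD (g_phil (acm a)). Qed.

Let Q_sym X Y Z : Q X Y Z = Q X Z Y.
Proof.
have H := congr1 (fun h => X h : Cinf M) (A_sym Y Z).
rewrite /= !(vfield_metric nablaP) (gC gP (A Y)) (gC gP Y) in H.
by rewrite /Q /S !(gE gP) !A_sym; apply/CinfP => x; at_pt x H; lra.
Qed.

(** Derivative of A phi = phi A; the terms in [e] come from nabla phi. *)
Let Q_phi a X Y Z :
  Q X (phi a Y) Z = - Q X Y (phi a Z) - eta a Y * e X Z - eta a Z * e X Y.
Proof.
rewrite /Q /S /e /E A_phi !nabla_phi A_eta !AE A_phi A_xi !(gE gP).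
rewrite !(g_phil (acm a)) (A_sym (A X) Y) (gC gP (xi a)) -(etaE (acm a)).
ring.
Qed.

Let Q_xil a X Z : Q X (xi a) Z = e X (phi a Z).
Proof.
rewrite /Q /S A_xi (nablaZr nablaP) vfield_const scale0r add0r nabla_xi A_phi.
rewrite /e /E !(gE gP) !(g_phil (acm a)).
ring.
Qed.
Let Q_xir a X Z : Q X Z (xi a) = e X (phi a Z).
Proof. by rewrite Q_sym Q_xil. Qed.

Let QD U X Y Z : Q (U + X) Y Z = Q U Y Z + Q X Y Z.
Proof.
rewrite /Q /S !(nablaDl nablaP) AD !(gE gP); ring.
Qed.
Let QZ (u : Cinf M) X Y Z : Q (u *: X) Y Z = u * Q X Y Z.
Proof. by rewrite /Q /S !(nablaZl nablaP) AZ !(gE gP) mulrBr. Qed.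
Let QN X Y Z : Q (- X) Y Z = - Q X Y Z.
Proof. by rewrite -[- X]scaleN1r QZ mulN1r. Qed.

(** This is d (d eta_a) = 0 with d eta_a = 2 [o]: derivatives of the arguments cancel against the
    brackets, derivatives of A give [Q], and those of phi_a give [e]. *)
Let Q_closed a X Y Z :
  Q Y X (phi a Z) - Q X Y (phi a Z) - Q Z X (phi a Y) - eta a Y * e X Z = 0.
Proof.
pose o U W := g (phi a (A U)) W.
have o_skew U W : o U W = - o W U.
  by rewrite /o (g_phil (acm a)) A_sym A_phi (gC gP).
have dE U W : ext_d1 (eta a) U W = constf 2 * o U W.
  by rewrite (ext_d1_xi (qs a) nablaP) nabla_xi.
have vf_o (U B C : V) : U (o B C) = o (nabla U B) C - o (nabla U C) B
    - Q U B (phi a C) + eta a B * constf k * g (A U) C - g (A U) (A B) * eta a C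
    :> Cinf M.
  have SE : nabla U (A B) = S U B + A (nabla U B) by rewrite /S subrK.
  rewrite (o_skew (nabla U C)) opprK /o (vfield_metric nablaP).
  rewrite nabla_phi A_eta SE.
  rewrite phiD !(gE gP) (g_phil (acm a) (S U B)) (gC gP (xi a)) -(etaE (acm a)).
  by rewrite /Q; ring.
have := ext_d2_ext_d1 (eta a) X Y Z; rewrite /ext_d2 !dE !vfieldM !vfield_const.
have oB U W C : o (U - W) C = o U C - o W C.
  by rewrite /o !AE !phiE !(gE gP).
rewrite !vf_o !(bracket_nabla nablaP) !oB (gC gP (A Y) (A X)) => H.
rewrite (A_sym Z Y) (gC gP Z (A Y)) (A_sym Z (A X)) (gC gP Z) in H.
by apply/CinfP => x; at_pt x H; rewrite /e /E !(gE gP) !CinfE; lra.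
Qed.

Let eD X Y Z : e X (Y + Z) = e X Y + e X Z.
Proof. by rewrite /e (gDr gP). Qed.
Let eN X Y : e X (- Y) = - e X Y.
Proof. by rewrite /e (gNr gP). Qed.
Let eZ X (u : Cinf M) Y : e X (u *: Y) = u * e X Y.
Proof. by rewrite /e (gZr gP). Qed.
Let QDr X Y Z W : Q X Y (Z + W) = Q X Y Z + Q X Y W.
Proof. by rewrite /Q (gDr gP). Qed.
Let QNr X Y Z : Q X Y (- Z) = - Q X Y Z.
Proof. by rewrite /Q (gNr gP). Qed.
Let QZr X Y (u : Cinf M) Z : Q X Y (u *: Z) = u * Q X Y Z.
Proof. by rewrite /Q (gZr gP). Qed.

(** The vertical component X = [xi b] of [Q_closed]: two of the three [Q] terms reduce to [e] by
    [Q_xil]. *)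
Let Q_xi1_phi a b d Y Z : cyclic3 a b d ->
  Q (xi b) Y (phi a Z) = - constf 2 * e Y (phi d Z).
Proof.
move=> abd; have H := Q_closed a (xi b) Y Z.
rewrite e_xil !Q_xil !(phi_mulC tqs abd) !eD !eN !eZ !e_xir in H.
have H1 := e_phi d Y Z; rewrite e_sym in H1.
by apply/CinfP => x; at_pt x H; at_pt x H1; lra.
Qed.

(* The left-hand side is symmetric in Y and Z, the right-hand side skew. *)
Let Q_xi1 a b d Y Z : cyclic3 a b d ->
  Q (xi b) Y Z = constf 2 * e Y (phi b Z).
Proof.
move=> abd; have := Q_xi1_phi Y (phi a Z) abd.
have dab := cyclic3_rot (cyclic3_rot abd).
rewrite (phi2 (acm a)) (phi_mul tqs dab) QDr QNr QZr Q_xir e_xil eD eZ e_xir.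
by move=> H; apply/CinfP => x; at_pt x H; lra.
Qed.

Let e0 X Y : e X Y = 0.
Proof.
have abd : cyclic3 0 (0 + 1) (0 + 1 + 1) by [].
set b := 0 + 1 in abd.
have ephi W Z : e W (phi b Z) = 0.
  have H := Q_sym (xi b) W Z; rewrite !(Q_xi1 _ _ abd) in H.
  have H1 := e_phi b Z W; rewrite e_sym in H1.
  by apply/CinfP => x; at_pt x H; at_pt x H1; lra.
(* Since [e] vanishes on [xi b], phi_b^2 acts as -1 inside [e]. *)
have := ephi X (phi b Y); rewrite (phi2 (acm b)) eD eN eZ e_xir => H.
by apply/CinfP => x; at_pt x H; lra.
Qed.

Lemma shape_idem X : A (A X) = constf k *: A X.
Proof. by apply/subr0_eq/(g_inj gP) => Y; rewrite (g0l gP); exact: e0. Qed.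

Let Q_xi1_eq0 b Y Z : Q (xi b) Y Z = 0.
Proof.
have abd : cyclic3 (b + 1 + 1) b (b + 1) by split; rewrite ?ord3_rot.
by rewrite (Q_xi1 _ _ abd) e0 mulr0.
Qed.
Let Q_xir_eq0 b X Z : Q X Z (xi b) = 0. Proof. by rewrite Q_xir e0. Qed.

Let Q_phiE a X Y Z : Q X (phi a Y) Z = - Q X Y (phi a Z).
Proof. by rewrite Q_phi !e0 !mulr0 !subr0. Qed.

(* The right-hand side does not depend on a. *)
Let Q_phi1 a X Y Z : Q (phi a Z) X (phi a Y) = Q X Y Z - Q Y X Z.
Proof.
have := Q_closed a X Y (phi a Z).
rewrite (phi2 (acm a)) !QDr !QNr !QZr !Q_xir_eq0 e0 => H.
by apply/CinfP => x; at_pt x H; lra.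
Qed.

(* Evaluates Q (phi a (phi b Z)) X (phi a Y) by [Q_phi1] at a, and again with
   phi a (phi b Z) replaced by phi d Z. *)
Let Q_antisym a b d X Y Z : cyclic3 a b d ->
  Q Z X (phi b Y) = Q (phi b X) Y Z - Q Y (phi b X) Z.
Proof.
move=> abd; have bda := cyclic3_rot abd.
have H1 := Q_phi1 a X Y (phi b Z).
rewrite -(Q_phi1 b) in H1.
rewrite (phi2 (acm b)) QD QN QZ Q_xi1_eq0 in H1.
rewrite (phi_mul tqs abd) QD QZ Q_xi1_eq0 in H1.
have -> : Q Z X (phi b Y) = - Q (phi d Z) X (phi a Y).
  by apply/CinfP => x; at_pt x H1; lra.
have -> : phi a Y = phi b (phi d Y) - (eta d Y : Cinf M) *: xi b.
  by rewrite (phi_mul tqs bda) addrK.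
by rewrite QDr QNr QZr Q_xir_eq0 mulr0 subr0 -Q_phiE Q_phi1.
Qed.

(** Freed of [phi b], [Q_antisym] becomes [Qb]: its left-hand side is symmetric in [B] and [C], its
    right-hand side skew. *)
Lemma shape_parallel X Y : nabla X (A Y) = A (nabla X Y).
Proof.
apply/subr0_eq/(g_inj gP) => Z; rewrite (g0l gP) -/(Q X Y Z).
have abd : cyclic3 0 (0 + 1) (0 + 1 + 1) by [].
set b := 0 + 1 in abd.
have Qb U C B : Q U B C = Q C B U - Q B C U.
  have := Q_antisym (phi b B) C U abd.
  rewrite Q_phiE (Q_sym C) !(phi2 (acm b)) QD QN QZ !QDr !QNr !QZr.
  rewrite Q_xi1_eq0 !Q_xir_eq0 (Q_sym C) => H.
  by apply/CinfP => x; at_pt x H; lra.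
have H1 := Qb X Y Z; have H2 := Qb X Z Y.
rewrite (Q_sym X Z) (Q_sym _ Z) (Q_sym _ Y) in H1 H2 *.
apply/CinfP => x; at_pt x H1; at_pt x H2. lra.
Qed.

(** The left-hand side is the commutator of R_XY with phi_a, paired with W. As A is parallel,
    differentiating [nabla_phi] again leaves only derivatives of eta_a and xi_a, which [nabla_xi]
    supplies. *)
Lemma curvature_phi a X Y Z W :
  g (curvature nabla X Y (phi a Z)) W + g (curvature nabla X Y Z) (phi a W)
  = g (phi a (A X)) Z * g (A Y) W - g (A Y) Z * g (phi a (A X)) W
    - (g (phi a (A Y)) Z * g (A X) W - g (A X) Z * g (phi a (A Y)) W).
Proof.
have Xeta (U : V) :
    U (eta a Z) = eta a (nabla U Z) + g (phi a (A U)) Z :> Cinf M.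
  by rewrite !(etaE (acm a)) (vfield_metric nablaP) nabla_xi (gC gP Z).
have Ab : A (bracket X Y) = A (nabla X Y) - A (nabla Y X).
  by rewrite (bracket_nabla nablaP) !AE.
rewrite /curvature !nabla_phi !(nablaE nablaP) !nabla_phi !nabla_xi Ab.
rewrite !shape_parallel !(vfield_metric nablaP) !Xeta !shape_parallel !(gE gP).
rewrite !(g_phil (acm a) (nabla _ _)).
ring.
Qed.

(** * The tensors psi_a and P_a expressed through A *)

Section Psi.
Hypothesis k_neq0 : k != 0.
Context {psi : 'I_3 -> {linear V -> V}}.
Hypothesis psiP : is_psi phi eta g psi.

Let kV : constf k^-1 * constf k = 1 :> Cinf M.
Proof. by apply/CinfP => x; rewrite !CinfE mulVf. Qed.

Let dE a X Y : ext_d1 (eta a) X Y = constf 2 * g (phi a (A X)) Y.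
Proof. by rewrite (ext_d1_xi (qs a) nablaP) nabla_xi. Qed.

Lemma psiE a X : psi a X = constf k^-1 *: phi a (A X).
Proof.
apply/vfieldP => f; apply/CinfP => x.
(* A/k is a symmetric projection; [P] and [X - P] are the components of X in the two distributions,
   on which psi is prescribed. *)
set P := constf k^-1 *: A X.
have AP : A P = A X by rewrite AZ shape_idem scalerA kV scale1r.
have P_tangent : in_E4l3 eta g P x.
  move=> Y [Y_H Y_E].
  (* On this test vector d eta_0(Y, .) equals 2k g(X, A Y) at x, because eta_0(Y) vanishes there. *)
  have := Y_E 0 (phi 0 (A X)).
  rewrite dE (g_phi (acm 0)) !A_eta (gC gP) A_sym shape_idem.
  rewrite (gZr gP) /P (gZl gP) A_sym !CinfE (Y_H 0) => H.
  have : k * (g X (A Y)) x = 0 by lra.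
  by move/eqP; rewrite mulf_eq0 (negPf k_neq0) => /eqP ->; rewrite mulr0.
have P_normal : in_E4m eta (X - P) x.
  split=> [b|b Y].
    rewrite linearB linearZ_LR A_eta.
    change (eta b X x - k^-1 * (k * eta b X x) = 0).
    by field.
  by rewrite dE AD AN AP subrr linear0 (g0l gP) mulr0.
have HP : psi a P f x = phi a P f x.
  exact: (congr1 (@^~ f) ((psiP a P x).1 P_tangent)).
have HN : psi a (X - P) f x = 0.
  exact: (congr1 (@^~ f) ((psiP a (X - P) x).2 P_normal)).
rewrite -phiZ -/P -[in LHS](subrK P X) linearD.
change (psi a (X - P) f x + psi a P f x = phi a P f x).
by rewrite HN HP add0r.
Qed.

Lemma g_psi a X Y : g X (psi a Y) = - (constf k^-1 * g (phi a (A X)) Y).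
Proof. by rewrite psiE (gZr gP) -A_phi -A_sym (g_phil (acm a)) mulrN opprK. Qed.

Lemma g_psi2 a X Y :
  g X (psi a (psi a Y)) = - (constf k^-1 * g (A X) Y) + eta a X * eta a Y.
Proof.
rewrite !g_psi A_phi shape_idem (phi2 (acm a)) !linearZ_LR A_eta !(gE gP).
rewrite (gC gP (xi a)) -(etaE (acm a)).
by apply/CinfP => x; rewrite !CinfE; field.
Qed.

(** The products of eta in [g_psi2] cancel the explicit eta terms of P, and the prefactor k^2 clears
    the inverses of k. *)
Lemma P_tensorE a X Y Z W :
  P_tensor (2 * k) (eta a) (psi a) g X Y Z W =
  g (phi a (A Y)) Z * g (A X) W - g (A X) Z * g (phi a (A Y)) W
    - (g (phi a (A X)) Z * g (A Y) W - g (A Y) Z * g (phi a (A X)) W).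
Proof.
rewrite /P_tensor /fund_form !g_psi2 !g_psi.
by apply/CinfP => x; rewrite !CinfE; field.
Qed.
End Psi.

End ParallelShape.

Theorem corollary3p6 (R : realType) (n l : nat) (M : manifold R (4 * n + 3))
    (phi : 'I_3 -> {linear vfield M -> vfield M}) (xi : 'I_3 -> vfield M)
    (eta : 'I_3 -> {scalar vfield M}) (g : vfield M -> vfield M -> Cinf M)
    (c : R) (nabla : vfield M -> vfield M -> vfield M)
    (psi : 'I_3 -> {linear vfield M -> vfield M}) :
  three_quasi_sasakian phi xi eta g ->
  (forall a, has_rank (eta a) (4 * l + 3)) ->
  for_even_perms (fun a b d => bracket (xi a) (xi b) = constf c *: xi d) ->
  levi_civita g nabla ->
  is_psi phi eta g psi ->
  forall (a : 'I_3) (X Y Z W : vfield M),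
    g (curvature nabla X Y (phi a Z)) W + g (curvature nabla X Y Z) (phi a W)
    = - P_tensor c (eta a) (psi a) g X Y Z W.
Proof.
move=> tqs _ xi_bracket nablaP psiP a X Y Z W.
have AD := shapeD tqs nablaP xi_bracket.
have AZ := shapeZ tqs nablaP xi_bracket.
have A_sym := shape_sym tqs nablaP xi_bracket.
have A_phi := shape_phi tqs nablaP xi_bracket.
have A_xi := shape_xi tqs nablaP xi_bracket.
have A_nxi := nabla_xi tqs nablaP xi_bracket.
have A_nphi := nabla_phi tqs nablaP xi_bracket.
rewrite (curvature_phi tqs nablaP AD AZ A_sym A_phi A_xi A_nxi A_nphi).
have AA := shape_idem tqs nablaP AD AZ A_sym A_phi A_xi A_nxi A_nphi.
have gP := acm_metric (qs_acm (tqs_qs tqs 0)).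
(* If c = 0 then A^2 = 0, so the symmetric operator A vanishes, and P vanishes through its factor
   c^2. *)
have [c0|c_neq0] := eqVneq c 0.
  have A0 (U : vfield M) : @shape _ _ M phi xi eta nabla c U = 0.
    apply: (g_eq0 gP); rewrite A_sym AA (gZr gP).
    by apply/CinfP => x; rewrite !CinfE c0; ring.
  rewrite !A0 !(linear0, g0l gP) /P_tensor.
  by apply/CinfP => x; rewrite !CinfE c0; field.
have k_neq0 : - (c / 2) != 0 by rewrite oppr_eq0 mulf_neq0 ?invr_eq0 ?pnatr_eq0.
have H := P_tensorE tqs nablaP AD AZ A_sym A_phi A_xi A_nxi A_nphi
  k_neq0 psiP a X Y Z W.
rewrite -[LHS]opprK opprB -H /P_tensor.
(* Here 2k = -c, and P contains only the square of c. *)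
by congr (- (_ * _)); apply/CinfP => x; rewrite !CinfE; field.
Qed.
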